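(* The class of (left-)quantum-MV algebras is term-equivalent to the class of (left-)quantum-Wajsberg algebras. Explicitly, the transformations $$\Phi:\ x\odot y:=(x\to y^* )^*,\qquad \Psi:\ x\to y:=(x\odot y^* )^*$$ (keeping ${}^*$ and $1$ unchanged) are mutually inverse between the two classes: if $(X,\to,{}^*,1)$ is a quantum-Wajsberg algebra, then $(X,\odot,{}^*,1)$ with $\odot$ given by $\Phi$ is a quantum-MV algebra; if $(X,\odot,{}^*,1)$ is a quantum-MV algebra, then $(X,\to,{}^*,1)$ with $\to$ given by $\Psi$ is a quantum-Wajsberg algebra; and applying $\Phi$ and $\Psi$ successively, in either order, gives back the original algebra.
   Context: A BE algebra is an algebra $(X,\to,1)$ of type $(2,0)$ such that for all $x,y,z\in X$: $x\to x=1$; $x\to 1=1$; $1\to x=x$; $x\to(y\to z)=y\to(x\to z)$. Write $x\le y$ iff $x\to y=1$. It is bounded if there is $0\in X$ with $0\le x$ for all $x$; then $x^*:=x\to 0$. A bounded BE algebra is involutive if $x^{**}=x$ for all $x$; it is then written $(X,\to,{}^*,1)$, with $0=1^*$. In an involutive BE algebra put $x\vee y:=(x\to y)\to y$ and $x\wedge y:=(x^*\vee y^* )^*=((x^*\to y^* )\to y^* )^*$. A quantum-Wajsberg algebra is an involutive BE algebra satisfying $x\to ((x\wedge y)\wedge (z\wedge x))=(x\to y)\wedge (x\to z)$ for all $x,y,z\in X$. An involutive left-m-BE algebra is an algebra $(X,\odot,{}^*,1)$ of type $(2,1,0)$ such that, with $0:=1^*$, for all $x,y,z\in X$: $1\odot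 x=x=x\odot 1$; $x\odot y=y\odot x$; $x\odot(y\odot z)=(x\odot y)\odot z$; $x\odot 0=0$; $x\odot x^*=0$; $x^{**}=x$. In it put $x\wedge_m^M y:=(x^*\odot y)^*\odot y$ and $x\vee_m^M y:=(x^*\wedge_m^M y^* )^*$. A (left-)quantum-MV algebra is an involutive left-m-BE algebra satisfying $x\odot((x^*\vee_m^M y)\vee_m^M(z\vee_m^M x^* ))=(x\odot y)\vee_m^M(x\odot z)$ for all $x,y,z\in X$. *)

(* Defs.v *)
Set Implicit Arguments.
Unset Strict Implicit.
Unset Printing Implicit Defensive.

(* An algebra of type (2,1,0).  Both classes below live on this one type: the
   binary operation is read as the implication in a quantum-Wajsberg algebra and
   as the product in a quantum-MV algebra. *)
Record algebra : Type := Algebra {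
  carrier : Type;
  bop : carrier -> carrier -> carrier;
  star : carrier -> carrier;
  one : carrier
}.

Record is_BE (X : Type) (imp : X -> X -> X) (one : X) : Prop := {
  BE_refl : forall x, imp x x = one;
  BE_top : forall x, imp x one = one;
  BE_unit : forall x, imp one x = x;
  BE_exchange : forall x y z, imp x (imp y z) = imp y (imp x z)
}.

Definition BE_le (X : Type) (imp : X -> X -> X) (one : X) (x y : X) : Prop :=
  imp x y = one.

Definition is_bottom (X : Type) (imp : X -> X -> X) (one zero : X) : Prop :=
  forall x, BE_le imp one zero x.

(* The unary operation is the one induced by a bottom element [zero]; then
   [zero = imp one zero = star one], so [zero] is determined by [star] and
   [one]. *)
Definition is_involutive_BE (X : Type) (imp : X -> X -> X) (star : X -> X)
    (one : X) : Prop :=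
  is_BE imp one /\
  (exists zero, is_bottom imp one zero /\ forall x, star x = imp x zero) /\
  (forall x, star (star x) = x).

Definition join (X : Type) (imp : X -> X -> X) (x y : X) : X :=
  imp (imp x y) y.

Definition meet (X : Type) (imp : X -> X -> X) (star : X -> X) (x y : X) : X :=
  star (join imp (star x) (star y)).

Definition quantum_Wajsberg (A : algebra) : Prop :=
  let X := carrier A in
  let imp : X -> X -> X := @bop A in
  let star : X -> X := @star A in
  let meet : X -> X -> X := meet imp star in
  is_involutive_BE imp star (one A) /\
  (forall x y z : X,
     imp x (meet (meet x y) (meet z x)) = meet (imp x y) (imp x z)).

Record is_involutive_mBE (X : Type) (prod : X -> X -> X) (star : X -> X)
    (one : X) : Prop := {
  mBE_unitl : forall x, prod one x = x;
  mBE_unitr : forall x, prod x one = x;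
  mBE_comm : forall x y, prod x y = prod y x;
  mBE_assoc : forall x y z, prod x (prod y z) = prod (prod x y) z;
  mBE_zero : forall x, prod x (star one) = star one;
  mBE_compl : forall x, prod x (star x) = star one;
  mBE_invol : forall x, star (star x) = x
}.

Definition meetM (X : Type) (prod : X -> X -> X) (star : X -> X) (x y : X) : X :=
  prod (star (prod (star x) y)) y.

Definition joinM (X : Type) (prod : X -> X -> X) (star : X -> X) (x y : X) : X :=
  star (meetM prod star (star x) (star y)).

Definition quantum_MV (A : algebra) : Prop :=
  let X := carrier A in
  let prod : X -> X -> X := @bop A in
  let star : X -> X := @star A in
  let joinM : X -> X -> X := joinM prod star in
  is_involutive_mBE prod star (one A) /\
  (forall x y z : X,
     prod x (joinM (joinM (star x) y) (joinM z (star x)))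
     = joinM (prod x y) (prod x z)).

(* The formulas for [Phi] and [Psi] coincide; only the reading of [bop] as
   implication or product differs. *)
Definition Phi (A : algebra) : algebra :=
  let imp := @bop A in
  let prod x y := star (imp x (star y)) in
  Algebra prod (@star A) (one A).

Definition Psi (A : algebra) : algebra :=
  let prod := @bop A in
  let imp x y := star (prod x (star y)) in
  Algebra imp (@star A) (one A).

Inductive term (V : Type) : Type :=
| Var (v : V)
| Bop (s t : term V)
| Star (t : term V)
| One.

Fixpoint eval (A : algebra) (V : Type) (f : V -> carrier A) (t : term V)
    : carrier A :=
  match t with
  | Var v => f v
  | Bop s t => bop (eval f s) (eval f t)
  | Star t => star (eval f t)
  | One _ => one A
  end.

(* A term for each basic operation; the variables of the binary one are [true]
   (first argument) and [false] (second argument). *)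
Record translation : Type := Translation {
  tr_bop : term bool;
  tr_star : term unit;
  tr_one : term Empty_set
}.

Definition translate (tr : translation) (A : algebra) : algebra :=
  {| carrier := carrier A;
     bop := fun x y => eval (fun b : bool => if b then x else y) (tr_bop tr);
     star := fun x => eval (fun _ : unit => x) (tr_star tr);
     one := eval (fun e : Empty_set => match e with end) (tr_one tr) |}.

Definition mutually_inverse (K L : algebra -> Prop) (F G : algebra -> algebra)
    : Prop :=
  (forall A, K A -> L (F A)) /\
  (forall B, L B -> K (G B)) /\
  (forall A, K A -> G (F A) = A) /\
  (forall B, L B -> F (G B) = B).

Definition term_equivalent (K L : algebra -> Prop) : Prop :=
  exists s t : translation, mutually_inverse K L (translate s) (translate t).

(* Main.v *)
(** By involution, [x -> y* = y -> x*], and the two transformations are one and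
    the same operation on terms, [(x . y* )*].  Under it the quantum-Wajsberg
    meet becomes the quantum-MV meet, so the two distributivity axioms are
    instances of each other, up to complementing [y], [z] and both sides. *)

From Stdlib Require Import FunctionalExtensionality.
Require Import Defs.

Set Implicit Arguments.
Unset Strict Implicit.

Section InvolutiveBE.

Variables (X : Type) (imp : X -> X -> X) (star : X -> X) (one : X).
Hypothesis invBE : is_involutive_BE imp star one.

Lemma involutive_BE_star_imp (x : X) : star x = imp x (star one).
Proof.
  destruct invBE as [BE [[zero [_ starE]] _]].
  rewrite (starE one), (BE_unit BE); apply starE.
Qed.

(** Contraposition is the exchange axiom with [star one] as the innermost argument. *)
Lemma involutive_BE_imp_starC (x y : X) : imp x (star y) = imp y (star x).
Proof.
  destruct invBE as [BE _].
  rewrite (involutive_BE_star_imp y), (involutive_BE_star_imp x).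
  apply (BE_exchange BE).
Qed.

Lemma involutive_BE_to_mBE :
  is_involutive_mBE (fun x y => star (imp x (star y))) star one.
Proof.
  destruct invBE as [BE [_ starK]].
  split; intros.
  - now rewrite (BE_unit BE), starK.
  - now rewrite <- involutive_BE_star_imp, starK.
  - now rewrite involutive_BE_imp_starC.
  (* Associativity: under the outer [star], the sides are [imp x (imp y (star z))] and, by
     contraposition, [imp z (imp x (star y))]. Contraposing the inner [imp y (star z)] leaves an
     exchange of [x] and [z]. *)
  - rewrite starK, (involutive_BE_imp_starC (star _) z), starK.
    rewrite (involutive_BE_imp_starC y z).
    now rewrite (BE_exchange BE).
  - now rewrite starK, (BE_top BE).
  - now rewrite starK, (BE_refl BE).
  - apply starK.
Qed.

End InvolutiveBE.

Lemma involutive_mBE_to_BE (X : Type) (prod : X -> X -> X) (star : X -> X)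
    (one : X) :
  is_involutive_mBE prod star one ->
  is_involutive_BE (fun x y => star (prod x (star y))) star one.
Proof.
  intros mBE; pose proof (mBE_invol mBE) as starK.
  split; [split; intros | split; [exists (star one); split |]].
  - now rewrite (mBE_compl mBE), starK.
  - now rewrite (mBE_zero mBE), starK.
  - now rewrite (mBE_unitl mBE), starK.
  (* Exchange: the nested implication is the complement of [prod x (prod y (star z))], in which [x]
     and [y] may be swapped. *)
  - rewrite !starK, !(mBE_assoc mBE).
    now rewrite (mBE_comm mBE x y).
  - intros x; unfold BE_le.
    now rewrite (mBE_comm mBE), (mBE_zero mBE), starK.
  - intros x; now rewrite starK, (mBE_unitr mBE).
  - exact starK.
Qed.

Lemma quantum_Wajsberg_Phi (A : algebra) :
  quantum_Wajsberg A -> quantum_MV (Phi A).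
Proof.
  destruct A as [X imp star one]; intros [invBE law].
  split; [exact (involutive_BE_to_mBE invBE) |].
  pose proof (proj2 (proj2 invBE)) as starK.
  (* The new product of [x] and [y] is the complement of [imp x (star y)], hence these instances. *)
  intros x y z; specialize (law x (star y) (star z)).
  cbn in *; unfold meet, join, joinM, meetM in *.
  rewrite !starK in *.
  now rewrite law.
Qed.

Lemma quantum_MV_Psi (B : algebra) : quantum_MV B -> quantum_Wajsberg (Psi B).
Proof.
  destruct B as [X prod star one]; intros [mBE law].
  split; [exact (involutive_mBE_to_BE mBE) |].
  pose proof (mBE_invol mBE) as starK.
  intros x y z; specialize (law x (star y) (star z)).
  cbn in *; unfold meet, join, joinM, meetM in *.
  rewrite !starK in *.
  now rewrite law.
Qed.

(** The composite operation is [imp x y] with two double complements inserted. Assuming just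
    involution makes the lemma serve both orders of composition. *)
Lemma Psi_Phi (A : algebra) :
  (forall x : carrier A, star (star x) = x) -> Psi (Phi A) = A.
Proof.
  destruct A as [X imp star one]; intros starK.
  unfold Psi, Phi; cbn in *; f_equal.
  apply functional_extensionality; intros x.
  apply functional_extensionality; intros y.
  now rewrite !starK.
Qed.

Definition dual_translation : translation :=
  {| tr_bop := Star (Bop (Var true) (Star (Var false)));
     tr_star := Star (Var tt);
     tr_one := One Empty_set |}.

Theorem theorem5p1 :
  term_equivalent quantum_MV quantum_Wajsberg /\
  (forall A : algebra, quantum_Wajsberg A -> quantum_MV (Phi A)) /\
  (forall B : algebra, quantum_MV B -> quantum_Wajsberg (Psi B)) /\
  (forall A : algebra, quantum_Wajsberg A -> Psi (Phi A) = A) /\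
  (forall B : algebra, quantum_MV B -> Phi (Psi B) = B).
Proof.
  assert (PsiK : forall A, quantum_Wajsberg A -> Psi (Phi A) = A).
  { intros A [[_ [_ starK]] _]; exact (Psi_Phi starK). }
  (* [Phi (Psi B)] and [Psi (Phi B)] are convertible. *)
  assert (PhiK : forall B, quantum_MV B -> Phi (Psi B) = B).
  { intros B [mBE _]; exact (Psi_Phi (mBE_invol mBE)). }
  split.
  (* One translation serves both ways: [translate dual_translation] is convertible to [Phi] and to
     [Psi]. *)
  - exists dual_translation, dual_translation.
    exact (conj quantum_MV_Psi (conj quantum_Wajsberg_Phi (conj PhiK PsiK))).
  - exact (conj quantum_Wajsberg_Phi (conj quantum_MV_Psi (conj PsiK PhiK))).
Qed.
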